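(* Let $A$ be a unital associative $k$-algebra and let $j\in\mathcal{U}(QSh(A),A)$ be the map with $j(1)=1_A$, $j(a_1)=a_1$ and $j(a_1\cdots a_r)=0$ for $r\ge2$. The convolution inverse $j^{\ast-1}$ of $j$ in $\mathcal{U}(QSh(A),A)$ is given by $j^{\ast-1}(1)=1_A$ and, for $s\ge1$ and $\boldsymbol a=a_1\cdots a_s\in A^{\otimes s}$, $$j^{\ast-1}(\boldsymbol a)=(-1)^s\,a_1\cdot_A\cdots\cdot_Aa_s=j\circ S(\boldsymbol a),$$ where $S$ is the antipode of the Hopf algebra $QSh(A)$.
   Context: Everything is over a fixed field $k$ of characteristic $0$. $QSh(A)=\bigoplus_{n\ge0}A^{\otimes n}$, $A^{\otimes0}=k$, with $a_1\otimes\cdots\otimes a_n$ written as the word $a_1\cdots a_n$ (not to be confused with the product in $A$, denoted $\cdot_A$); unit $1\in A^{\otimes 0}$; product $\star$ given by $1\star v=v\star1=v$, $av\star bw=a(v\star bw)+b(av\star w)+(a\cdot_Ab)(v\star w)$ for $a,b\in A$ and words $v,w$; coproduct the deconcatenation $\Delta(a_1\cdots a_s)=\sum_{r=0}^s(a_1\cdots a_r)\otimes(a_{r+1}\cdots a_s)$; counit $\eta$ zero on words of length $\ge1$. It is a conilpotent bialgebra (for each element $h$ of $\ker\eta$, a sufficiently high iterate of the reduced coproduct $\Delta'(h)=\Delta(h)-1\otimes h-h\otimes1$ vanishes), hence a Hopf algebra. $\mathcal{U}(QSh(A),A)$ is the set of linear maps $f:QSh(A)\to A$ with $f(1)=1_A$;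 it is a group for the convolution product $f\ast g=m_A\circ(f\otimes g)\circ\Delta$ ($m_A$ the product of $A$), with unit $u_A\circ\eta$ ($u_A:k\to A$ the unit map). *)

(* Defs.v *)
From HB Require Import structures.
From mathcomp Require Import all_boot all_order all_algebra finmap.
From mathcomp Require Import boolp.
From mathcomp.multinomials Require Import monalg.

Set Implicit Arguments.
Unset Strict Implicit.
Unset Printing Implicit Defensive.

Import GRing.Theory.
Local Open Scope ring_scope.

Section Free.
Variables (k : fieldType) (K : choiceType) (N : lmodType k) (phi : K -> N).

Definition free_lift (g : {malg k[K]}) : N := \sum_(x <- msupp g) g@_x *: phi x.

Lemma free_liftE (d : {fset K}) g :
  (msupp g `<=` d)%fset -> free_lift g = \sum_(x <- d) g@_x *: phi x.
Proof.
move=> le; rewrite /free_lift (big_fset_incl _ le) // => x _ /mcoeff_outdom ->.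
by rewrite scale0r.
Qed.

Lemma free_lift_is_linear : linear free_lift.
Proof.
move=> c g h.
pose d := (msupp g `|` msupp h `|` msupp (c *: g + h))%fset.
rewrite !(@free_liftE d) ?fsubsetUr //.
- by rewrite scaler_sumr -big_split; apply: eq_bigr => x _;
    rewrite mcoeffD mcoeffZ scalerDl scalerA.
- by rewrite /d -fsetUA fsubsetU // fsubsetU // ?orbT ?fsubset_refl // orbT.
by rewrite /d -fsetUA fsubsetU // fsubset_refl.
Qed.
HB.instance Definition _ := GRing.isLinear.Build k {malg k[K]} N _ free_lift
  free_lift_is_linear.

Lemma free_liftU x : free_lift (mkmalgU x 1) = phi x.
Proof.
by rewrite (@free_liftE [fset x]%fset) ?msuppU_le // big_seq_fset1 mcoeffUU scale1r.
Qed.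
End Free.

Lemma malg_expand (k : fieldType) (K : choiceType) (g : {malg k[K]}) :
  g = free_lift (fun x => mkmalgU x 1) g.
Proof.
rewrite {1}[g]monalgE; apply: eq_bigr => x _; apply/malgP => y.
by rewrite mcoeffZ !mcoeffU mulrnAr mulr1.
Qed.

Lemma linear_eqP (k : fieldType) (U V : lmodType k) (f g : {linear U -> V}) :
  f =1 g -> f = g.
Proof.
case: f => f [[f1] [f2]]; case: g => g [[g1] [g2]] /= /funext e.
by case: _ / e in g1 g2 *; congr (GRing.Linear.Pack (GRing.Linear.Class _ _));
  congr (_ _); apply: Prop_irrelevance.
Qed.

(* Quotient of a k-module V by the submodule relspan generated by rels, packaged *)
(* as a module with a surjective linear map from V whose kernel is relspan.      *)
Section Quotient.
Variables (k : fieldType) (V : lmodType k) (rels : V -> Prop).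

Inductive relspan : V -> Prop :=
| relspan0 : relspan 0
| relspanD c r v : rels r -> relspan v -> relspan (c *: r + v).

Record quotmod := Quotmod {
  quot_sort :> lmodType k;
  quot_pi : {linear V -> quot_sort};
  quot_surj : forall x, exists v, quot_pi v = x;
  quot_ker : forall v, quot_pi v = 0 <-> relspan v }.

Definition relspan_pred : pred V := fun v => `[< relspan v >].

Lemma relspan_lin c u v : relspan u -> relspan v -> relspan (c *: u + v).
Proof.
move=> Hu Hv; elim: Hu => [|d r g' rr _ IH]; first by rewrite scaler0 add0r.
by rewrite scalerDr scalerA -addrA; apply: relspanD.
Qed.

Lemma relspan_zmod_closed : zmod_closed relspan_pred.
Proof.
split=> [|g h /asboolP Hg /asboolP Hh]; apply/asboolP; first exact: relspan0.
by rewrite addrC -scaleN1r; apply: relspan_lin.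
Qed.
HB.instance Definition _ :=
  GRing.isZmodClosed.Build V relspan_pred relspan_zmod_closed.

Definition quot_car : Type :=
  @Quotient.quot V (GRing.ZmodClosed.clone _ relspan_pred _).
HB.instance Definition _ := GRing.Zmodule.on quot_car.

Let pi (v : V) : quot_car :=
  \pi_(@Quotient.quot V (GRing.ZmodClosed.clone _ relspan_pred _))%qT v.
Let repr (x : quot_car) : V := generic_quotient.repr
  (x : @Quotient.quot V (GRing.ZmodClosed.clone _ relspan_pred _)).

Let reprK : cancel repr pi. Proof. exact: generic_quotient.reprK. Qed.

Let piP u v : pi u = pi v <-> relspan (u - v).
Proof.
split=> [/eqP|H].
  by rewrite -[_ == _]Quotient.idealrBE => /asboolP.
by apply/eqP; rewrite -[_ == _]Quotient.idealrBE; apply/asboolP.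
Qed.

Let piD : {morph pi : u v / u + v}.
Proof. by move=> u v; rewrite /pi raddfD. Qed.

Definition quot_scale (c : k) (x : quot_car) := pi (c *: repr x).

Let piZ c v : pi (c *: v) = quot_scale c (pi v).
Proof.
apply/piP; rewrite -scalerBr -[_ *: _]addr0; apply: relspan_lin relspan0.
by apply/piP; rewrite reprK.
Qed.

Fact quot_scaleA a b x : quot_scale a (quot_scale b x) = quot_scale (a * b) x.
Proof. by rewrite -[x]reprK -!piZ scalerA. Qed.
Fact quot_scale1 : left_id 1 quot_scale.
Proof. by move=> x; rewrite -[x]reprK -!piZ scale1r. Qed.
Fact quot_scaleDr : right_distributive quot_scale +%R.
Proof.
move=> a x y; rewrite -[x]reprK -[y]reprK.
by rewrite -piD -!piZ scalerDr piD.
Qed.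
Fact quot_scaleDl x : {morph quot_scale^~ x : a b / a + b}.
Proof. by move=> a b; rewrite -[x]reprK -!piZ scalerDl piD. Qed.
HB.instance Definition _ := GRing.Zmodule_isLmodule.Build k quot_car
  quot_scaleA quot_scale1 quot_scaleDr quot_scaleDl.

Fact quot_pi_is_linear : linear pi.
Proof. by move=> c u v; rewrite piD piZ. Qed.
HB.instance Definition _ :=
  GRing.isLinear.Build k V quot_car _ pi quot_pi_is_linear.

Lemma quotmod_ex : quotmod.
Proof.
exists quot_car pi => [x|v]; first by exists (repr x); apply: reprK.
by rewrite -(linear0 pi) -[v in relspan v]subr0; apply: piP.
Qed.
End Quotient.

(* The k-module presented by the generators K and the relations rels. *)
Section Presented.
Variables (k : fieldType) (K : choiceType) (rels : {malg k[K]} -> Prop).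

Definition presmod : lmodType k := quotmod_ex rels.

Definition pres_pi : {linear {malg k[K]} -> presmod} := quot_pi (quotmod_ex rels).

Definition pres_gen (x : K) : presmod := pres_pi (mkmalgU x 1).

Lemma pres_rel r : rels r -> pres_pi r = 0.
Proof.
move=> rr; apply/quot_ker; rewrite -[r]scale1r -[_ *: _]addr0.
by apply: relspanD => //; exact: relspan0.
Qed.

Lemma pres_ext (N : lmodType k) (f g : {linear presmod -> N}) :
  (forall x, f (pres_gen x) = g (pres_gen x)) -> f =1 g.
Proof.
move=> efg x; have [v <-] := quot_surj x.
rewrite (malg_expand v) /free_lift !linear_sum /=.
by apply: eq_bigr => y _; rewrite !linearZ /=; congr (_ *: _); apply: efg.
Qed.

Lemma pres_ind (P : presmod -> Prop) :
  P 0 -> (forall c x y, P x -> P y -> P (c *: x + y)) ->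
  (forall x, P (pres_gen x)) -> forall x, P x.
Proof.
move=> P0 PD Pgen x; have [v <-] := quot_surj x.
rewrite (malg_expand v) /free_lift linear_sum /=.
by elim/big_rec: _ => // y z _ Pz; rewrite linearZ; apply: PD => //; apply: Pgen.
Qed.

Lemma pres_lift_ex (N : lmodType k) (phi : K -> N) :
  (forall r, rels r -> free_lift phi r = 0) ->
  {f : {linear presmod -> N} | forall x, f (pres_gen x) = phi x}.
Proof.
move=> phi0; pose repr (x : presmod) := sval (cid (quot_surj x)).
have reprK x : pres_pi (repr x) = x by rewrite /repr; case: cid.
pose f x := free_lift phi (repr x).
have fE v : f (pres_pi v) = free_lift phi v.
  apply/eqP; rewrite /f -subr_eq0 -linearB /=; apply/eqP.
  have: relspan rels (repr (pres_pi v) - v).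
    by apply/quot_ker; rewrite linearB /=; apply/eqP; rewrite subr_eq0; apply/eqP/reprK.
  elim=> [|c r h rr _ IH]; first by rewrite linear0.
  by rewrite linearP /= IH phi0 // scaler0 addr0.
have f_lin : linear f.
  by move=> c x y; rewrite -[x]reprK -[y]reprK -linearP !fE linearP.
pose F := GRing.isLinear.Build k presmod N _ f f_lin.
pose fl : {linear presmod -> N} := HB.pack f F.
by exists fl => x; rewrite [LHS]fE free_liftU.
Qed.
End Presented.

Section Tensor.
Variables (k : fieldType) (M N : lmodType k).

Inductive tensor_rel : {malg k[(M * N)%type]} -> Prop :=
| TensorRelL c x x' y : tensor_rel (mkmalgU (c *: x + x', y) 1
    - (c *: mkmalgU (x, y) 1 + mkmalgU (x', y) 1))
| TensorRelR c x y y' : tensor_rel (mkmalgU (x, c *: y + y') 1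
    - (c *: mkmalgU (x, y) 1 + mkmalgU (x, y') 1)).

Definition tensor : lmodType k := presmod tensor_rel.

Definition tens (x : M) (y : N) : tensor := pres_gen tensor_rel (x, y).

Lemma tens_linl c x x' y : tens (c *: x + x') y = c *: tens x y + tens x' y.
Proof.
apply/eqP; rewrite -subr_eq0 /tens /pres_gen -linearP -linearB /=; apply/eqP.
by apply: pres_rel; exact: TensorRelL.
Qed.

Lemma tens_linr c x y y' : tens x (c *: y + y') = c *: tens x y + tens x y'.
Proof.
apply/eqP; rewrite -subr_eq0 /tens /pres_gen -linearP -linearB /=; apply/eqP.
by apply: pres_rel; exact: TensorRelR.
Qed.

Definition bilin (P : lmodType k) (phi : M -> N -> P) :=
  (forall y, linear (phi^~ y)) /\ (forall x, linear (phi x)).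

Lemma tens_bilin : bilin tens.
Proof. by split=> [y c x x'|x c y y']; rewrite (tens_linl, tens_linr). Qed.

Lemma tensor_ext (P : lmodType k) (f g : {linear tensor -> P}) :
  (forall x y, f (tens x y) = g (tens x y)) -> f =1 g.
Proof. by move=> e; apply: pres_ext => -[x y]; apply: e. Qed.

Section Lift.
Variables (P : lmodType k) (phi : M -> N -> P) (phiP : bilin phi).

Fact tensor_lift_subproof r : tensor_rel r -> free_lift (uncurry phi) r = 0.
Proof.
by case=> [c x x' y|c x y y']; rewrite linearB linearP /= !free_liftU /=
  ?(proj1 phiP) ?(proj2 phiP) subrr.
Qed.

Definition tensor_lift : {linear tensor -> P} :=
  sval (pres_lift_ex tensor_lift_subproof).

Lemma tensor_liftE x y : tensor_lift (tens x y) = phi x y.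
Proof. exact: (svalP (pres_lift_ex tensor_lift_subproof) (x, y)). Qed.
End Lift.
End Tensor.

Section TensorMap.
Variables (k : fieldType) (M N M' N' : lmodType k).
Variables (f : {linear M -> M'}) (g : {linear N -> N'}).

Fact tensor_map_bilin : bilin (fun x y => tens (f x) (g y)).
Proof.
by split=> [y c x x'|x c y y']; rewrite linearP (tens_linl, tens_linr).
Qed.

Definition tensor_map : {linear tensor M N -> tensor M' N'} :=
  tensor_lift tensor_map_bilin.

Lemma tensor_mapE x y : tensor_map (tens x y) = tens (f x) (g y).
Proof. exact: tensor_liftE. Qed.
End TensorMap.

Section TensorMul.
Variables (k : fieldType) (B : algType k).

Fact mul_bilin : bilin (fun x y : B => x * y).
Proof.
by split=> [y c x x'|x c y y']; rewrite ?mulrDl ?mulrDr -?scalerAl -?scalerAr.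
Qed.

Definition tensor_mul : {linear tensor B B -> B} := tensor_lift mul_bilin.

Lemma tensor_mulE x y : tensor_mul (tens x y) = x * y.
Proof. exact: tensor_liftE. Qed.
End TensorMul.

Section Words.
Variables (k : fieldType) (A : algType k).

Definition multilin (P : lmodType k) (phi : seq A -> P) :=
  forall p q c a b,
    phi (p ++ (c *: a + b) :: q) = c *: phi (p ++ a :: q) + phi (p ++ b :: q).

Inductive word_rel : {malg k[seq A]} -> Prop :=
| WordRel p q c a b : word_rel (mkmalgU (p ++ (c *: a + b) :: q) 1
    - (c *: mkmalgU (p ++ a :: q) 1 + mkmalgU (p ++ b :: q) 1)).

(* The summands A^{(x)n} are presented all at once: the generators are the words *)
(* in A, of any length, and the relations express linearity in each letter.      *)
(* Relations only involve words of one length, so that QSh is the direct sum     *)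
(* over n of the modules A^{(x)n}, with A^{(x)0} spanned by the empty word.      *)
Definition QSh : Type := presmod word_rel.
HB.instance Definition _ := GRing.Lmodule.on QSh.

Definition word (w : seq A) : QSh := pres_gen word_rel w.

Lemma word_multilin : multilin word.
Proof.
move=> p q c a b.
apply/eqP; rewrite -subr_eq0 /word /pres_gen -linearP -linearB /=; apply/eqP.
by apply: pres_rel; exact: WordRel.
Qed.

Lemma word_ext (P : lmodType k) (f g : {linear QSh -> P}) :
  (forall w, f (word w) = g (word w)) -> f =1 g.
Proof. exact: pres_ext. Qed.

Lemma word_ind (P : QSh -> Prop) :
  P 0 -> (forall c x y, P x -> P y -> P (c *: x + y)) ->
  (forall w, P (word w)) -> forall x, P x.
Proof. exact: pres_ind. Qed.

Section Lift.
Variables (P : lmodType k) (phi : seq A -> P) (phiP : multilin phi).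

Fact word_lift_subproof r : word_rel r -> free_lift phi r = 0.
Proof.
by case=> p q c a b; rewrite linearB linearP /= !free_liftU phiP subrr.
Qed.

Definition word_lift : {linear QSh -> P} :=
  sval (pres_lift_ex word_lift_subproof).

Lemma word_liftE w : word_lift (word w) = phi w.
Proof. exact: (svalP (pres_lift_ex word_lift_subproof) w). Qed.
End Lift.

Lemma lin_multilin (P : lmodType k) (f : {linear QSh -> P}) :
  multilin (fun v => f (word v)).
Proof. by move=> p q c a b /=; rewrite word_multilin linearP. Qed.

(* The linear map induced on words by op o (F (x) G) o Delta. *)
Section Split.
Variables (P Q R : lmodType k) (op : P -> Q -> R) (opP : bilin op).

Definition wsplit (F : seq A -> P) (G : seq A -> Q) (w : seq A) : R :=
  \sum_(r < (size w).+1) op (F (take r w)) (G (drop r w)).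

Lemma wsplit_nil F G : wsplit F G [::] = op (F [::]) (G [::]).
Proof. by rewrite /wsplit big_ord1. Qed.

Lemma wsplit_cons F G a w :
  wsplit F G (a :: w) = op (F [::]) (G (a :: w)) + wsplit (F \o cons a) G w.
Proof. by rewrite /wsplit big_ord_recl. Qed.

Lemma wsplit_linl c F F' G w :
  wsplit (fun v => c *: F v + F' v) G w = c *: wsplit F G w + wsplit F' G w.
Proof.
rewrite /wsplit scaler_sumr -big_split; apply: eq_bigr => r _ /=.
by rewrite opP.1.
Qed.

Lemma eq_wsplit F F' G G' w : F =1 F' -> G =1 G' -> wsplit F G w = wsplit F' G' w.
Proof. by move=> eF eG; apply: eq_bigr => r _; rewrite eF eG. Qed.

Lemma wsplit_multilin F G : multilin F -> multilin G -> multilin (wsplit F G).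
Proof.
move=> HF HG p; elim: p F HF => [|d p IH] F HF q c a b /=.
  rewrite !wsplit_cons (HG [::]) opP.2.
  rewrite (@eq_wsplit _ (fun v => c *: (F \o cons a) v + (F \o cons b) v) G G) //.
    by rewrite wsplit_linl scalerDr addrACA.
  by move=> v; apply: (HF [::]).
rewrite !wsplit_cons (HG (d :: p)) opP.2 IH; last by move=> p'; apply: (HF (d :: p')).
by rewrite scalerDr addrACA.
Qed.
End Split.
End Words.

Fact prep_multilin (k : fieldType) (A : algType k) (a : A) :
  multilin (fun w => word (a :: w) : QSh A).
Proof. by move=> p q c b b'; apply: (word_multilin (a :: p)). Qed.

(* Concatenation of a letter on the left, v |-> av. *)
HB.lock Definition prep (k : fieldType) (A : algType k) (a : A) :
  {linear QSh A -> QSh A} := word_lift (prep_multilin a).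

Section QuasiShuffle.
Variables (k : fieldType) (A : algType k).
Local Notation Q := (QSh A).

Lemma prep_word (a : A) w : prep a (word w) = word (a :: w).
Proof. by rewrite prep.unlock word_liftE. Qed.

Lemma prep_linl (x : Q) c a b : prep (c *: a + b) x = c *: prep a x + prep b x.
Proof.
pose f : {linear Q -> Q} := c \*: prep a \+ prep b.
by apply: (@word_ext _ _ _ (prep (c *: a + b)) f) => w;
  rewrite /f /= !prep_word (word_multilin [::]).
Qed.

Lemma prep_linr (a : A) c x y : prep a (c *: x + y) = c *: prep a x + prep a y.
Proof. exact: linearP. Qed.

(* av * bw = a(v * bw) + b(av * w) + (a . b)(v * w) on words *)
Fixpoint qsh (u : seq A) : seq A -> Q :=
  if u is a :: u' then
    fix qsh_u v := if v is b :: v' then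
      prep a (qsh u' v) + prep b (qsh_u v') + prep (a * b) (qsh u' v')
    else word u
  else fun v => word v.

Lemma qsh0s v : qsh [::] v = word v. Proof. by []. Qed.
Lemma qshs0 u : qsh u [::] = word u. Proof. by case: u. Qed.
Lemma qsh_cons a u b v : qsh (a :: u) (b :: v) =
  prep a (qsh u (b :: v)) + prep b (qsh (a :: u) v) + prep (a * b) (qsh u v).
Proof. by []. Qed.

Lemma add3_lin (c : k) (x1 x2 x3 y1 y2 y3 : Q) :
  (c *: x1 + y1) + (c *: x2 + y2) + (c *: x3 + y3) =
  c *: (x1 + x2 + x3) + (y1 + y2 + y3).
Proof. by rewrite !scalerDr [_ + _ + (c *: x2 + y2)]addrACA [LHS]addrACA. Qed.

Lemma qsh_multilinr u : multilin (qsh u).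
Proof.
elim: u => [|a u IHu] p; first exact: word_multilin.
elim: p => [|d p IHp] q c b b'; rewrite ?cat0s ?cat_cons !qsh_cons.
  have := IHu [::] q c b b'; rewrite !cat0s => ->.
  by rewrite prep_linr mulrDr -scalerAr !prep_linl add3_lin.
have := IHu (d :: p) q c b b'; rewrite !cat_cons => ->.
by rewrite IHp IHu !prep_linr add3_lin.
Qed.

Lemma qsh_multilinl v : multilin (qsh^~ v).
Proof.
move=> p; elim: p v => [|d p IHp] v q c a a'; elim: v => [|b v IHv].
- by rewrite !qshs0; apply: (word_multilin [::]).
- rewrite !cat0s in IHv *; rewrite !qsh_cons IHv.
  by rewrite mulrDl -scalerAl prep_linr !prep_linl add3_lin.
- by rewrite !qshs0; apply: (word_multilin (d :: p)).
rewrite !cat_cons in IHv *; rewrite !qsh_cons IHv !IHp.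
by rewrite !prep_linr add3_lin.
Qed.

Definition qmulr u : {linear Q -> Q} := word_lift (qsh_multilinr u).

Fact qmulr_multilin y : multilin (qmulr^~ y).
Proof.
move=> p q c a b.
pose f : {linear Q -> Q} := c \*: qmulr (p ++ a :: q) \+ qmulr (p ++ b :: q).
apply: (@word_ext _ _ _ (qmulr _) f) => w.
by rewrite /f /qmulr /= !word_liftE; apply: qsh_multilinl.
Qed.

End QuasiShuffle.

HB.lock Definition qmul (k : fieldType) (A : algType k) (x y : QSh A) : QSh A :=
  word_lift (qmulr_multilin y) x.

Section QuasiShuffleRing.
Variables (k : fieldType) (A : algType k).
Local Notation Q := (QSh A).

Lemma qmul_word (u v : seq A) : qmul (word u) (word v) = qsh u v.
Proof. by rewrite qmul.unlock !word_liftE. Qed.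

Lemma qmul_linl (y : Q) c x x' :
  qmul (c *: x + x') y = c *: qmul x y + qmul x' y.
Proof. by rewrite qmul.unlock linearP. Qed.

Lemma qmul_linr (x : Q) c y y' :
  qmul x (c *: y + y') = c *: qmul x y + qmul x y'.
Proof.
rewrite qmul.unlock; pose f : {linear Q -> Q} :=
  c \*: word_lift (qmulr_multilin y) \+ word_lift (qmulr_multilin y').
apply: (@word_ext _ _ _ (word_lift (qmulr_multilin _)) f) => w.
by rewrite /f /= !word_liftE linearP.
Qed.

Lemma qmul0l (y : Q) : qmul 0 y = 0.
Proof. by have := qmul_linl y (-1) 0 0; rewrite scaler0 addr0 scaleN1r addNr. Qed.

Lemma qmul0r (x : Q) : qmul x 0 = 0.
Proof. by have := qmul_linr x (-1) 0 0; rewrite scaler0 addr0 scaleN1r addNr. Qed.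

Fact qmul1l : left_id (word [::] : Q) (@qmul k A).
Proof.
elim/word_ind => [|c x y ex ey|w]; first exact: qmul0r.
  by rewrite qmul_linr ex ey.
by rewrite qmul_word.
Qed.

Fact qmul1r : right_id (word [::] : Q) (@qmul k A).
Proof.
elim/word_ind => [|c x y ex ey|w]; first exact: qmul0l.
  by rewrite qmul_linl ex ey.
by rewrite qmul_word qshs0.
Qed.

Lemma prep0 (a : A) : prep a 0 = 0. Proof. exact: linear0. Qed.
Lemma prepD (a : A) : {morph prep a : x y / x + y}. Proof. exact: linearD. Qed.

Lemma qmul_prep (a b : A) (x y : Q) : qmul (prep a x) (prep b y) =
  prep a (qmul x (prep b y)) + prep b (qmul (prep a x) y) + prep (a * b) (qmul x y).
Proof.
elim/word_ind: x => [|c x x' ex ex'|u].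
- by rewrite prep0 !qmul0l !prep0 !addr0.
- by rewrite prep_linr !qmul_linl ex ex' !prep_linr add3_lin.
elim/word_ind: y => [|c x x' ex ex'|v].
- by rewrite prep0 !qmul0r !prep0 !addr0.
- by rewrite prep_linr !qmul_linr ex ex' !prep_linr add3_lin.
by rewrite !prep_word !qmul_word.
Qed.

Fact qmulDl : left_distributive (@qmul k A) +%R.
Proof. by move=> x y z; rewrite -[x]scale1r qmul_linl !scale1r. Qed.

Fact qmulDr : right_distributive (@qmul k A) +%R.
Proof. by move=> x y z; rewrite -[y]scale1r qmul_linr !scale1r. Qed.

Lemma qmul_prepA (a b c : A) (x y z : Q) :
  qmul (prep a x) (qmul (prep b y) (prep c z)) =
  prep a (qmul x (qmul (prep b y) (prep c z)))
  + prep b (qmul (prep a x) (qmul y (prep c z)))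
  + prep (a * b) (qmul x (qmul y (prep c z)))
  + prep c (qmul (prep a x) (qmul (prep b y) z))
  + prep (a * c) (qmul x (qmul (prep b y) z))
  + prep (b * c) (qmul (prep a x) (qmul y z))
  + prep (a * (b * c)) (qmul x (qmul y z)).
Proof.
rewrite (qmul_prep b c) !qmulDr !qmul_prep !prepD !addrA.
by rewrite [LHS](ACl (1*4*7*2*3*5*6*8*9)).
Qed.

Lemma qmul_prepAr (a b c : A) (x y z : Q) :
  qmul (qmul (prep a x) (prep b y)) (prep c z) =
  prep a (qmul (qmul x (prep b y)) (prep c z))
  + prep b (qmul (qmul (prep a x) y) (prep c z))
  + prep (a * b) (qmul (qmul x y) (prep c z))
  + prep c (qmul (qmul (prep a x) (prep b y)) z)
  + prep (a * c) (qmul (qmul x (prep b y)) z)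
  + prep (b * c) (qmul (qmul (prep a x) y) z)
  + prep (a * b * c) (qmul (qmul x y) z).
Proof.
rewrite (qmul_prep a b) !qmulDl !qmul_prep !prepD !addrA.
by rewrite [LHS](ACl (1*4*7*2*5*8*3*6*9)).
Qed.

Fact qmulA : associative (@qmul k A).
Proof.
move=> x y z; elim/word_ind: x => [|d x x' ex ex'|u]; first by rewrite !qmul0l.
  by rewrite !qmul_linl ex ex'.
elim/word_ind: y => [|d y y' ey ey'|v]; first by rewrite !(qmul0l, qmul0r).
  by rewrite !(qmul_linl, qmul_linr) ey ey'.
elim/word_ind: z => [|d z z' ez ez'|w]; first by rewrite !qmul0r.
  by rewrite !qmul_linr ez ez'.
elim: u v w => [|a u IHu] v w; first by rewrite !qmul1l.
elim: v w => [|b v IHv] w; first by rewrite qmul1l qmul1r.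
elim: w => [|c w IHw]; first by rewrite !qmul1r.
rewrite -!prep_word qmul_prepA qmul_prepAr !prep_word.
by rewrite !IHu !IHv IHw mulrA.
Qed.

Definition counit_word (w : seq A) : k^o := (w == [::])%:R.

Fact counit_multilin : multilin counit_word.
Proof. by case=> [|d p] q c a b; rewrite /counit_word /= scaler0 addr0. Qed.

Definition counit : {linear Q -> k^o} := word_lift counit_multilin.

Lemma counit_word_nil : counit (word [::]) = 1.
Proof. by rewrite word_liftE /counit_word eqxx. Qed.

Fact qone_neq0 : word [::] != 0 :> Q.
Proof.
by apply: contra_eq_neq counit_word_nil => ->; rewrite linear0 eq_sym oner_eq0.
Qed.

HB.instance Definition _ := GRing.Zmodule_isNzRing.Build Q
  qmulA qmul1l qmul1r qmulDl qmulDr qone_neq0.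

Lemma word0 : word [::] = 1 :> Q. Proof. by []. Qed.

Lemma word_cons_mul (a b : A) (v w : seq A) :
  word (a :: v) * word (b :: w) =
  prep a (word v * word (b :: w)) + prep b (word (a :: v) * word w)
  + prep (a * b) (word v * word w) :> Q.
Proof. by rewrite -!prep_word; apply: qmul_prep. Qed.

Fact qscalerAl (c : k) (x y : Q) : c *: (x * y) = c *: x * y.
Proof. by have := qmul_linl y c x 0; rewrite qmul0l !addr0. Qed.
HB.instance Definition _ := GRing.Lmodule_isLalgebra.Build k Q qscalerAl.

Fact qscalerAr (c : k) (x y : Q) : c *: (x * y) = x * (c *: y).
Proof. by have := qmul_linr x c y 0; rewrite qmul0r !addr0. Qed.
HB.instance Definition _ := GRing.Lalgebra_isAlgebra.Build k Q qscalerAr.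
End QuasiShuffleRing.

Section Coproduct.
Variables (k : fieldType) (A : algType k).
Local Notation Q := (QSh A).

Fact coprod_multilin : multilin (fun w : seq A =>
  \sum_(r < (size w).+1) tens (word (take r w) : Q) (word (drop r w) : Q)).
Proof.
exact: (wsplit_multilin (tens_bilin _ _) (@word_multilin _ A) (@word_multilin _ A)).
Qed.

Definition coprod : {linear Q -> tensor Q Q} := word_lift coprod_multilin.

Lemma coprod_word w : coprod (word w) =
  \sum_(r < (size w).+1) tens (word (take r w)) (word (drop r w)).
Proof. exact: word_liftE. Qed.
End Coproduct.

Section Convolution.
Variables (k : fieldType) (A : algType k) (B : algType k).
Local Notation Q := (QSh A).
Implicit Types (f g h : {linear Q -> B}) (F G H : seq A -> B) (w : seq A).

(* f * g = m_B o (f (x) g) o Delta, where m_B is the product of B *)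
Definition conv f g : {linear Q -> B} :=
  tensor_mul B \o (tensor_map f g \o coprod A).

(* the unit u_B o eta of the convolution product *)
Definition conv1_fun (x : Q) : B := in_alg B (counit A x).
Fact conv1_is_linear : linear conv1_fun.
Proof. by move=> c x y; rewrite /conv1_fun linearP /= scalerDl scalerA. Qed.
HB.instance Definition _ :=
  GRing.isLinear.Build k Q B _ conv1_fun conv1_is_linear.
Definition conv1 : {linear Q -> B} := conv1_fun.

Local Notation wconv := (wsplit (fun x y : B => x * y)).
Let we w : B := (w == [::])%:R.

Lemma conv_word f g w : conv f g (word w) = wconv (fun v => f (word v)) (fun v => g (word v)) w.
Proof.
rewrite /conv /= coprod_word !linear_sum; apply: eq_bigr => r _ /=.
by rewrite tensor_mapE tensor_mulE.
Qed.

Lemma conv1_word w : conv1 (word w) = we w.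
Proof.
rewrite /conv1 /= /conv1_fun word_liftE /counit_word /we.
by case: (w == [::]); [exact: scale1r | exact: scale0r].
Qed.

Lemma wconvA F G H w : wconv (wconv F G) H w = wconv F (wconv G H) w.
Proof.
elim: w F => [|a w IH] F; first by rewrite !wsplit_nil mulrA.
rewrite !wsplit_cons wsplit_nil -IH mulrDr mulrA -addrA; congr (_ + _).
rewrite /wsplit mulr_sumr -big_split; apply: eq_bigr => r _ /=.
by rewrite -[X in X * _ = _]/(wconv F G (a :: take r w)) wsplit_cons mulrDl mulrA.
Qed.

Lemma wconv1l F w : wconv we F w = F w.
Proof.
case: w => [|a w]; first by rewrite wsplit_nil /we eqxx mul1r.
rewrite wsplit_cons {1}/we eqxx mul1r /wsplit big1 ?addr0 // => r _.
by rewrite /= /we /= mul0r.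
Qed.

Lemma wconv1r F w : wconv F we w = F w.
Proof.
elim: w F => [|a w IH] F; first by rewrite wsplit_nil /we eqxx mulr1.
by rewrite wsplit_cons IH {1}/we /= mulr0 add0r.
Qed.

Lemma eq_wconv_size F F' G G' w :
  (forall v, (size v <= size w)%N -> F v = F' v) ->
  (forall v, (size v <= size w)%N -> G v = G' v) ->
  wconv F G w = wconv F' G' w.
Proof.
move=> eF eG; apply: eq_bigr => r _; rewrite eF ?eG //.
  by rewrite size_drop leq_subr.
by rewrite size_take_min geq_minr.
Qed.

Lemma wconvDl F F' G w : wconv (F \+ F') G w = wconv F G w + wconv F' G w.
Proof. by rewrite -big_split; apply: eq_bigr => r _; rewrite mulrDl. Qed.
Lemma wconvDr F G G' w : wconv F (G \+ G') w = wconv F G w + wconv F G' w.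
Proof. by rewrite -big_split; apply: eq_bigr => r _; rewrite mulrDr. Qed.
Lemma wconvBl F F' G w : wconv (F \- F') G w = wconv F G w - wconv F' G w.
Proof. by rewrite -sumrB; apply: eq_bigr => r _; rewrite mulrBl. Qed.
Lemma wconvBr F G G' w : wconv F (G \- G') w = wconv F G w - wconv F G' w.
Proof. by rewrite -sumrB; apply: eq_bigr => r _; rewrite mulrBr. Qed.

Lemma we_multilin : multilin we.
Proof. by case=> [|d p] q c a b; rewrite /we /= scaler0 addr0. Qed.

Section Inverse.
Variable (F : seq A -> B).
Hypotheses (F1 : F [::] = 1) (F_multilin : multilin F).

(* partial sums of the Neumann series of F = we - G; they are stationary on *)
(* each word because G vanishes on the empty word                           *)
Let G := we \- F.
Fixpoint neumann n : seq A -> B :=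
  if n is n'.+1 then we \+ wconv G (neumann n') else we.
Definition winv w := neumann (size w) w.

Lemma neumannSr n w : neumann n.+1 w = we w + wconv (neumann n) G w.
Proof.
elim: n w => [|n IH] w; first by rewrite /= wconv1l wconv1r.
rewrite -[LHS]/(we w + wconv G (neumann n.+1) w); congr (_ + _).
rewrite (@eq_wconv_size _ G _ (we \+ wconv (neumann n) G)) //.
rewrite wconvDr -wconvA wconv1r.
by rewrite -[RHS]/(wconv (we \+ wconv G (neumann n)) G w) wconvDl wconv1l.
Qed.

Lemma neumann_stable n w : (size w <= n)%N -> neumann n w = winv w.
Proof.
suff S m v : (size v <= m)%N -> neumann m.+1 v = neumann m v.
  move=> /subnK <-; elim: (n - size w)%N => // m IH.
  by rewrite addSn S ?leq_addl.
elim: m v => [|m IH] v.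
  by case: v => // _; rewrite /= wsplit_nil /G /= F1 /we eqxx subrr mul0r addr0.
move=> le_v; rewrite -[neumann m.+1 v]/(we v + wconv G (neumann m) v).
rewrite -[LHS]/(we v + wconv G (neumann m.+1) v); congr (_ + _).
apply: eq_bigr => -[[|r] /= lt_r] _.
  by rewrite take0 /G /= F1 /we eqxx subrr !mul0r.
congr (_ * _); apply: IH; rewrite size_drop leq_subLR; apply: leq_trans le_v _.
by rewrite addSn ltnS leq_addl.
Qed.

Lemma wconvVr w : wconv F winv w = we w.
Proof.
rewrite (@eq_wconv_size _ (we \- G) _ (neumann (size w))) => [|v _|v le_v].
- rewrite wconvBl wconv1l (neumann_stable (leqnn _)) -(neumann_stable (leqnSn _)).
  by rewrite /= addrK.
- by rewrite /G /= opprB addrC subrK.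
by rewrite neumann_stable.
Qed.

Lemma wconvVl w : wconv winv F w = we w.
Proof.
rewrite (@eq_wconv_size _ (neumann (size w)) _ (we \- G)) => [|v le_v|v _].
- rewrite wconvBr wconv1r (neumann_stable (leqnn _)) -(neumann_stable (leqnSn _)).
  by rewrite neumannSr addrK.
- by rewrite neumann_stable.
by rewrite /G /= opprB addrC subrK.
Qed.

Lemma neumann_multilin n : multilin (neumann n).
Proof.
have G_multilin : multilin G.
  move=> p q c a b; rewrite /G /= we_multilin F_multilin.
  by rewrite scalerBr opprD addrACA.
elim: n => [|n IH]; first exact: we_multilin.
move=> p q c a b /=; rewrite we_multilin.
by rewrite (wsplit_multilin (mul_bilin B) G_multilin IH) scalerDr addrACA.
Qed.

Lemma winv_multilin : multilin winv.
Proof. by move=> p q c a b; rewrite /winv !size_cat /= neumann_multilin. Qed.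
End Inverse.

(* U(QSh(A), B), a group under convolution for every unital algebra B. *)
Record Umap := UMap { ufun :> {linear Q -> B}; ufun1 : ufun 1 = 1 }.
HB.instance Definition _ := gen_eqMixin Umap.
HB.instance Definition _ := gen_choiceMixin Umap.

Lemma UmapP (f g : Umap) : (forall w, f (word w) = g (word w)) -> f = g.
Proof.
case: f g => [f f1] [g g1] /= /word_ext /linear_eqP e.
by case: _ / e in g1 *; congr UMap; apply: Prop_irrelevance.
Qed.

Fact uone_subproof : conv1 1 = 1.
Proof. by rewrite [LHS](conv1_word [::]) /we eqxx. Qed.
Definition uone := UMap uone_subproof.

Fact umul_subproof (f g : Umap) : conv f g 1 = 1.
Proof. by rewrite [LHS](conv_word _ _ [::]) wsplit_nil /= !ufun1 mulr1. Qed.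
Definition umul (f g : Umap) := UMap (umul_subproof f g).

Fact uinv_multilin (f : Umap) : multilin (winv (fun v => f (word v))).
Proof. exact: winv_multilin (lin_multilin _). Qed.
Fact uinv_subproof (f : Umap) : word_lift (uinv_multilin f) 1 = 1.
Proof. by rewrite [LHS]word_liftE /winv /= /we eqxx. Qed.
Definition uinv (f : Umap) := UMap (uinv_subproof f).

Let umulE (f g : Umap) w :
  umul f g (word w) = wconv (fun v => f (word v)) (fun v => g (word v)) w.
Proof. exact: conv_word. Qed.
Let uoneE w : uone (word w) = we w. Proof. exact: conv1_word. Qed.
Let uinvE (f : Umap) w : uinv f (word w) = winv (fun v => f (word v)) w.
Proof. exact: word_liftE. Qed.

Fact umulA : associative umul.
Proof.
move=> f g h; apply: UmapP => w; rewrite (umulE f (umul g h)) (umulE (umul f g) h).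
transitivity (wconv (fun v => f (word v))
    (wconv (fun v => g (word v)) (fun v => h (word v))) w).
  by apply: eq_wsplit => // v; apply: umulE.
by rewrite -wconvA; apply: eq_wsplit => // v; rewrite umulE.
Qed.

Fact umul1f : left_id uone umul.
Proof.
move=> f; apply: UmapP => w; rewrite umulE -[RHS](wconv1l (fun v => f (word v))).
by apply: eq_wsplit => // v; apply: uoneE.
Qed.
Fact umulf1 : right_id uone umul.
Proof.
move=> f; apply: UmapP => w; rewrite umulE -[RHS](wconv1r (fun v => f (word v))).
by apply: eq_wsplit => // v; apply: uoneE.
Qed.
Fact umulVf : left_inverse uone uinv umul.
Proof.
move=> f; apply: UmapP => w; rewrite umulE uoneE.
rewrite -(@wconvVl (fun v => f (word v))); last exact: ufun1.
by apply: eq_wsplit => // v; apply: uinvE.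
Qed.
Fact umulfV : right_inverse uone uinv umul.
Proof.
move=> f; apply: UmapP => w; rewrite umulE uoneE.
rewrite -(@wconvVr (fun v => f (word v))); last exact: ufun1.
by apply: eq_wsplit => // v; apply: uinvE.
Qed.

HB.instance Definition _ :=
  isGroup.Build Umap umulA umul1f umulf1 umulVf umulfV.
End Convolution.

Section Antipode.
Variables (k : fieldType) (A : algType k).
Local Notation Q := (QSh A).

Definition jword (w : seq A) : A :=
  match w with [::] => 1 | [:: a] => a | _ => 0 end.

Fact jword_multilin : multilin jword.
Proof. by case=> [|d [|e p]] [|f q] c a b //=; rewrite scaler0 addr0. Qed.

Fact jmap_subproof : word_lift jword_multilin 1 = 1.
Proof. exact: word_liftE. Qed.
Definition jmap : Umap A A := UMap jmap_subproof.

Definition uid : Umap A Q := @UMap _ _ _ idfun (erefl 1).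

(* The antipode is the convolution inverse of the identity of QSh(A), which is an *)
(* element of the group U(QSh(A), QSh(A)).                                        *)
Definition antipode : {linear Q -> Q} := (uid^-1)%g : Umap A Q.

Lemma antipodeP :
  conv antipode idfun = conv1 A Q /\ conv idfun antipode = conv1 A Q.
Proof.
split; first exact: (congr1 (@ufun _ _ _) (mulVg uid)).
exact: (congr1 (@ufun _ _ _) (mulgV uid)).
Qed.

Lemma antipode_uniq (S : {linear Q -> Q}) :
  conv S idfun = conv1 A Q -> S = antipode.
Proof.
move=> eS; have S1 : S 1 = 1.
  have := congr1 (fun f : {linear Q -> Q} => f 1) eS.
  rewrite [LHS](conv_word S idfun [::]) wsplit_nil /= mulr1 => ->.
  exact: uone_subproof.
pose uS := UMap S1; have e : (uS * uid = 1)%g.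
  by apply: UmapP => w; rewrite -[LHS]/(conv S idfun (word w)) eS.
by rewrite /antipode -[uid^-1%g]mul1g -e mulgK.
Qed.
End Antipode.

(* Main.v *)
Require Import Defs.
From mathcomp Require Import all_boot all_order all_algebra.

(** The map [j] is multiplicative: every term of the quasi-shuffle product of
    words of lengths [p] and [q] has length at least [max p q], and the only
    term of length one in the product of two letters [a] and [b] is their product in
    [A]. Composing [S * id = u o eta] with [j] therefore shows that [j o S]
    is the convolution inverse of [j]. On the other hand, [j * j^-1] evaluated
    at a word [a w] has only two non-zero terms, which gives the recursion
    [j^-1 (a w) = - a . j^-1 (w)]. *)

Set Implicit Arguments.
Unset Strict Implicit.
Unset Printing Implicit Defensive.

Import GRing.Theory.
Local Open Scope ring_scope.

Section JMap.
Variables (k : fieldType) (A : algType k).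
Local Notation Q := (QSh A).
Implicit Types (a b : A) (v w : seq A) (x y : Q).

Lemma jmap_word w : jmap A (word w) = jword w.
Proof. exact: word_liftE. Qed.

Lemma counit_word w : counit A (word w) = (w == [::])%:R.
Proof. exact: word_liftE. Qed.

Lemma counit_prep a x : counit A (prep a x) = 0.
Proof.
elim/word_ind: x => [|c x y ex ey|w]; first by rewrite !linear0.
  by rewrite !linearP ex ey /= scaler0 addr0.
by rewrite prep_word counit_word.
Qed.

Lemma counit_mul_word v w :
  counit A (word v * word w) = (nilp v && nilp w)%:R.
Proof.
case: v w => [|a v] [|b w]; rewrite ?word0 ?mul1r ?mulr1 ?counit_word //.
by rewrite word_cons_mul !linearD /= !counit_prep !addr0.
Qed.

(** Prepending [a] yields length one only from the empty word, whose coefficient in [x] is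
    [counit A x]. *)
Lemma jmap_prep a x : jmap A (prep a x) = counit A x *: a.
Proof.
elim/word_ind: x => [|c x y ex ey|w]; first by rewrite !linear0 scale0r.
  by rewrite !linearP ex ey /= scalerDl scalerA.
rewrite prep_word jmap_word counit_word.
by case: w => [|b w] /=; rewrite ?scale1r ?scale0r.
Qed.

Lemma jmapM_word v w :
  jmap A (word v * word w) = jmap A (word v) * jmap A (word w).
Proof.
case: v w => [|a v] [|b w]; rewrite ?word0 ?ufun1 ?mul1r ?mulr1 ?ufun1 //.
rewrite word_cons_mul !linearD /= !jmap_prep !counit_mul_word !jmap_word /=.
(* The first two terms keep a whole non-empty factor, so only the merged letter [a * b] can
   survive. *)
rewrite andbF !scale0r !add0r.
by case: v w => [|? ?] [|? ?] /=; rewrite ?scale1r ?scale0r ?mul0r ?mulr0.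
Qed.

Lemma jmapM x y : jmap A (x * y) = jmap A x * jmap A y.
Proof.
elim/word_ind: x => [|c x x' ex ex'|v]; first by rewrite mul0r linear0 mul0r.
  by rewrite mulrDl -scalerAl !linearP ex ex' /= mulrDl -scalerAl.
elim/word_ind: y => [|c y y' ey ey'|w]; first by rewrite mulr0 linear0 mulr0.
  by rewrite mulrDr -scalerAr !linearP ey ey' /= mulrDr -scalerAr.
exact: jmapM_word.
Qed.

(** Convolution involves the target only through its product, which [j] preserves. *)
Lemma conv_jmap_comp (f g : {linear Q -> Q}) x :
  conv (jmap A \o f) (jmap A \o g) x = jmap A (conv f g x).
Proof.
apply: (@word_ext _ _ _ _ (jmap A \o conv f g)) => w.
rewrite conv_word -[RHS]/(jmap A (conv f g (word w))) conv_word /wsplit linear_sum.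
by apply: eq_bigr => r _; rewrite jmapM.
Qed.

Lemma jmap_conv1 x : jmap A (conv1 A Q x) = conv1 A A x.
Proof.
rewrite /conv1 /= /conv1_fun /= linearZ; congr (_ *: _).
exact: ufun1 (jmap A).
Qed.

Fact jmap_antipode1 : (jmap A \o antipode A) 1 = 1.
Proof.
transitivity (jmap A 1); last exact: ufun1.
congr (jmap A _); exact: (ufun1 ((uid A)^-1)%g).
Qed.

Definition jmap_antipode : Umap A A := UMap jmap_antipode1.

Lemma jmapV : ((jmap A)^-1)%g = jmap_antipode.
Proof.
suff e : (jmap_antipode * jmap A)%g = 1%g.
  by rewrite -[LHS]mul1g -e mulgK.
apply: UmapP => w.
(* Reading [j] as [j o id] lets [j] be pulled out of the convolution. *)
transitivity (conv (jmap A \o antipode A) (jmap A \o idfun) (word w)).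
  by rewrite [LHS]conv_word conv_word.
by rewrite conv_jmap_comp (antipodeP A).1 jmap_conv1.
Qed.

Lemma jmapV_cons a w :
  ((jmap A)^-1)%g (word (a :: w)) = - (a * ((jmap A)^-1)%g (word w)).
Proof.
have /(congr1 (fun f : Umap A A => f (word (a :: w)))) := mulgV (jmap A).
(* The cuts after zero and one letters are split off; every other prefix has length at least two,
   where [j] vanishes. *)
rewrite [LHS]conv_word [RHS]conv1_word /wsplit /= !big_ord_recl big1 => [|r _].
  by rewrite /= take0 !drop0 !jmap_word /= addr0 mul1r => /eqP; rewrite addr_eq0 => /eqP.
by case: w r => [[]|b w r] //=; rewrite jmap_word mul0r.
Qed.

Lemma jmapV_word w :
  ((jmap A)^-1)%g (word w) = (-1) ^+ size w * \prod_(a <- w) a.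
Proof.
elim: w => [|a w IH]; first by rewrite big_nil mulr1 word0 ufun1.
rewrite jmapV_cons IH big_cons exprS mulN1r mulNr; congr (- _).
(* Signs are central, even when [A] is noncommutative. *)
by rewrite !mulrA; congr (_ * _); apply/commr_sign.
Qed.

End JMap.

Theorem mainTheorem5 (k : fieldType) (char0 : [pchar k] =i pred0)
    (A : algType k) :
  let jinv : Umap A A := ((jmap A)^-1)%g in
  jinv 1 = 1 /\
  (forall (s : nat) (a : s.-tuple A), (1 <= s)%N ->
     jinv (word a) = (-1) ^+ s * \prod_(i < s) tnth a i /\
     (-1) ^+ s * \prod_(i < s) tnth a i = jmap A (antipode A (word a))).
Proof.
move=> jinv; split=> [|s a _]; first exact: ufun1.
have jinvE : jinv (word a) = (-1) ^+ s * \prod_(i < s) tnth a i.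
  by rewrite jmapV_word size_tuple big_tuple.
by split; rewrite // -jinvE /jinv jmapV.
Qed.
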